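(* Let $q>9$ be a power of an odd prime, let $\mathcal{Q}$ be the set of nonzero squares and $\mathcal{N}$ the set of nonsquares in $\mathrm{GF}(q)$. Let $\tau\in\mathrm{GF}(q)^*$, $B_\tau=\mathcal{Q}\,\triangle\,(\mathcal{Q}+\tau)$ (symmetric difference, with $\mathcal{Q}+\tau=\{x+\tau:x\in\mathcal{Q}\}$), $\mathcal{P}=\mathrm{GF}(q)$ and $\mathcal{B}=\{g(B_\tau):g\in\mathrm{GA}_1(q)\}$, where $\mathrm{GA}_1(q)=\{x\mapsto ax+b:a\in\mathrm{GF}(q)^*,b\in\mathrm{GF}(q)\}$. Then $(\mathcal{P},\mathcal{B})$ is a $2$-$(q,k,\lambda)$ design, where $$k=\begin{cases}\frac{q+1}{2} & \text{if } q\equiv 3\pmod 4,\\ \frac{q+3}{2} & \text{if } q\equiv 1\pmod 4\text{ and }\tau\in\mathcal{Q},\\ \frac{q-1}{2} & \text{if } q\equiv 1\pmod 4\text{ and }\tau\in\mathcal{N},\end{cases}\qquad \lambda=\begin{cases}k(k-1) & \text{if } q\equiv 3\pmod 4,\\ \frac{k(k-1)}{2} & \text{if } q\equiv 1\pmod 4.\end{cases}$$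
   Context: A $t$-$(v,k,\lambda)$ design is a pair $(\mathcal{P},\mathcal{B})$ with $|\mathcal{P}|=v$ and $\mathcal{B}$ a set of $k$-subsets of $\mathcal{P}$ (blocks) such that every $t$-subset of $\mathcal{P}$ lies in exactly $\lambda$ blocks. *)

(* Defs.v *)
From HB Require Import structures.
From mathcomp Require Import all_boot all_order all_algebra.

Set Implicit Arguments.
Unset Strict Implicit.
Unset Printing Implicit Defensive.

Import GRing.Theory.

(* [blocks] is a set of sets, so repeated blocks are not allowed. *)
Definition is_design (T : finType) (t v k lambda : nat)
    (points : {set T}) (blocks : {set {set T}}) : Prop :=
  [/\ #|points| = v,
      forall B : {set T}, B \in blocks -> B \subset points /\ #|B| = k &
      forall S : {set T}, S \subset points -> #|S| = t ->
        #|[set B in blocks | S \subset B]| = lambda].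

Definition symdiff (T : finType) (A B : {set T}) : {set T} :=
  (A :\: B) :|: (B :\: A).

Local Open Scope ring_scope.

Definition nonzero_squares (F : finFieldType) : {set F} :=
  [set x | (x != 0) && [exists y, x == y ^+ 2]].

(* 0 is a square, so it belongs neither to [nonsquares] nor to
   [nonzero_squares]. *)
Definition nonsquares (F : finFieldType) : {set F} :=
  [set x | ~~ [exists y, x == y ^+ 2]].

Definition GA1 (F : finFieldType) : {set {ffun F -> F}} :=
  [set g : {ffun F -> F} |
    [exists a : F, exists b : F, (a != 0) && (g == [ffun x => a * x + b])]].

Definition base_block (F : finFieldType) (tau : F) : {set F} :=
  symdiff (nonzero_squares F) [set x + tau | x in nonzero_squares F].

Definition GA1_blocks (F : finFieldType) (B : {set F}) : {set {set F}} :=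
  [set [set g x | x in B] | g : {ffun F -> F} in GA1 F].

(* Main.v *)
(* Since GA_1(q) is sharply 2-transitive, double counting gives
   lambda = k (k - 1) / |Stab B|, and the substitution u = 1 - tau / x turns
   the computation of k into counting nonsquares.  So everything rests on the
   stabiliser of B = B_tau, which is trivial for q = 3 mod 4 and equal to
   {x, tau - x} for q = 1 mod 4.

   Put e = (q - 1) / 2.  Away from x = 0 and x = tau, the indicator function of
   B is (1 - (x (x - tau)) ^ e) / 2, so the power sums of B about tau / 2 are
   explicit elements of GF(q) in which only the binomials C(e, j) occur, and
   these satisfy the recursion of C(-1/2, j).  If k != 0 in GF(q), a map
   x |-> a x + b preserving B fixes the centroid of B, and a ^ i = 1 whenever
   the i-th central power sum is nonzero; a few small i (depending on the
   characteristic) determine a.  In characteristic 3 with q = 1 mod 4 and tau a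
   square, k = 0 and there is no centroid; there the power sums of degrees 2, 5
   and 11 exclude the remaining maps. *)
Require Import Defs.
From mathcomp Require Import all_boot all_order all_algebra.
From mathcomp Require Import cyclic finfield zify ring.

Set Implicit Arguments.
Unset Strict Implicit.
Unset Printing Implicit Defensive.

Import GRing.Theory.

Local Open Scope ring_scope.

(** * Squares and power sums in a finite field of odd order *)

Section OddFiniteField.

Variables (F : finFieldType) (e : nat).
Hypothesis cardF : #|F| = e.*2.+1.

Local Notation Q := (nonzero_squares F).

Lemma half_gt0 : (0 < e)%N.
Proof.
have : (1 < #|F|)%N by rewrite (cardD1 0) (cardD1 1) !inE oner_eq0.
by rewrite cardF; case: (e).
Qed.

Lemma expf_double_half (x : F) : x != 0 -> x ^+ e.*2 = 1.
Proof.
move=> x0; apply: (mulfI x0).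
by rewrite -exprS -cardF expf_card mulr1.
Qed.

Lemma finField_prim_root : exists w : F, (e.*2).-primitive_root w.
Proof.
have [] := @hasP _ _ _ (@has_prim_root F e.*2 (enum [set~ (0 : F)]) _ _ _ _).
- by rewrite double_gt0 half_gt0.
- by apply/allP => x; rewrite mem_enum !inE unity_rootE => /expf_double_half ->.
- exact: enum_uniq.
- by rewrite -cardE cardsC1 cardF.
- by move=> w _ pw; exists w.
Qed.

(** For the converse write [x = w ^+ i] with [w] a primitive root: [x ^+ e = 1] says that [2 * e]
    divides [i * e], so [i] is even. *)
Lemma euler_criterion (x : F) : (x \in Q) = (x ^+ e == 1).
Proof.
rewrite inE; apply/idP/eqP => [/andP[x0 /existsP[y /eqP xE]]|xe].
  rewrite xE -exprM mul2n expf_double_half //.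
  by apply: contraNneq x0 => y0; rewrite xE y0 expr0n.
have [w pw] := finField_prim_root.
have x0 : x != 0.
  by apply: contra_eq_neq xe => ->; rewrite expr0n gtn_eqF ?half_gt0 // eq_sym oner_eq0.
have [[i ltie] /= xE] := prim_rootP pw (expf_double_half x0).
rewrite x0; apply/existsP; exists (w ^+ i./2).
rewrite -exprM muln2 xE; apply/eqP; congr (_ ^+ _).
move/eqP: xe; rewrite xE -exprM -(prim_order_dvd pw) -mul2n.
rewrite dvdn_pmul2r ?half_gt0 // dvdn2 => /negPf io.
by rewrite -[LHS](odd_double_half i) io.
Qed.

Lemma expf_half_sqr1 (x : F) : x != 0 -> (x ^+ e == 1) || (x ^+ e == -1).
Proof. by move=> x0; rewrite -sqrf_eq1 -exprM muln2 expf_double_half. Qed.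

Lemma two_neq0 : 2%:R != 0 :> F.
Proof.
have [w pw] := finField_prim_root.
by apply: (prim_root_dvd_eq0 pw); rewrite -muln2 dvdn_mull.
Qed.

Lemma opp1_neq1 : (-1 : F) != 1.
Proof.
apply: contra two_neq0 => /eqP h.
by rewrite mulr2n -{1}h addNr.
Qed.

(** A primitive root [w] has [w ^+ e = -1], so multiplication by [w] carries the nonzero squares
    bijectively onto the nonsquares; both sets have half of the [2 * e] nonzero elements. *)
Lemma card_nonzero_squares : #|Q| = e.
Proof.
have [w pw] := finField_prim_root.
have w0 : w != 0 by rewrite (prim_root_eq0 pw) double_eq0 -lt0n half_gt0.
have we : w ^+ e = -1.
  case/orP: (expf_half_sqr1 w0) => /eqP // h1.
  have := prim_order_dvd pw e; rewrite h1 eqxx => /(dvdn_leq half_gt0).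
  by rewrite -addnn -{3}[e]addn0 leq_add2l leqNgt half_gt0.
have sub : [set w * x | x in Q] = [set x | (x != 0) && (x \notin Q)].
  apply/setP => y; rewrite [in RHS]inE; apply/imsetP/andP => [[x xQ ->]|[y0 yQ]].
    have x0 : x != 0 by move: xQ; rewrite inE => /andP[].
    rewrite mulf_neq0 // euler_criterion exprMn we; split => //.
    by move: xQ; rewrite euler_criterion => /eqP ->; rewrite mulr1 opp1_neq1.
  exists (y / w); last by rewrite mulrCA divff ?mulr1.
  rewrite euler_criterion exprMn exprVn we.
  move: yQ (expf_half_sqr1 y0); rewrite euler_criterion => /negPf -> /= /eqP ->.
  by rewrite divff // oppr_eq0 oner_eq0.
have := cardsC [set (0 : F)]; rewrite cards1 cardF add1n => -[].
rewrite -(cardsID Q [set~ 0]) (_ : [set~ 0] :&: Q = Q); last first.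
  by apply/setIidPr/subsetP => x; rewrite !inE => /andP[].
rewrite (_ : [set~ 0] :\: Q = [set w * x | x in Q]); last first.
  by rewrite sub; apply/setP => x; rewrite !inE andbC.
by rewrite card_imset ?addnn; [apply: double_inj | apply: mulfI].
Qed.

Lemma card_nonzero_nonsquares : #|[set x : F | (x != 0) && (x \notin Q)]| = e.
Proof.
have := cardsC [set (0 : F)]; rewrite cards1 cardF add1n => -[].
rewrite -(cardsID Q [set~ 0]) (_ : [set~ 0] :&: Q = Q); last first.
  by apply/setIidPr/subsetP => x; rewrite !inE => /andP[].
rewrite card_nonzero_squares -addnn => /addnI h; rewrite -[RHS]h; apply: eq_card => x.
by rewrite !inE andbC.
Qed.

Lemma natr_card_finField : #|F|%:R = 0 :> F.
Proof.
have : \sum_(x : F) x = \sum_(x : F) (x + 1) by rewrite (reindex_inj (addIr 1)).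
by rewrite big_split /= sumr_const -[LHS]addr0 => /addrI ->.
Qed.

(** Substituting [w * y] for [y] multiplies the sum by [w ^+ N], so it vanishes unless
    [q - 1 = 2 * e] divides [N]. Below [2 * (q - 1)] this leaves [N = q - 1] and [N = 0]; in the
    latter case the convention [0 ^+ 0 = 1] makes the sum [q = 0]. *)
Lemma sum_expr (N : nat) : (N < (e.*2).*2)%N ->
  \sum_(y : F) y ^+ N = - (N == e.*2)%:R.
Proof.
move=> ltN; have [->|N0] := posnP N.
  rewrite (eq_bigr (fun=> 1)) => [|y _]; last by rewrite expr0.
  by rewrite sumr_const natr_card_finField eq_sym double_eq0 gtn_eqF ?half_gt0 // oppr0.
have [->|NE] := eqVneq N e.*2.
  rewrite (bigD1 0) //= expr0n double_eq0 gtn_eqF ?half_gt0 // add0r.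
  rewrite (eq_bigr (fun=> 1)) => [|y]; last exact: expf_double_half.
  rewrite sumr_const -[#|_|]/#|[pred y : F | y != 0]|.
  have := natr_card_finField; rewrite (cardD1 0) inE natrD => /eqP.
  rewrite addrC addr_eq0 => /eqP <-; congr _%:R; apply: eq_card => y.
  by rewrite !inE andbT.
have [w pw] := finField_prim_root.
have w0 : w != 0 by rewrite (prim_root_eq0 pw) double_eq0 -lt0n half_gt0.
have wN : w ^+ N != 1.
  rewrite -(prim_order_dvd pw); apply: contra NE => /dvdnP[k NEk].
  move: ltN N0; rewrite NEk -[X in (_ < X)%N]mul2n ltn_pmul2r ?double_gt0 ?half_gt0 //.
  by case: k {NEk} => [|[|[]]] // _ _; rewrite mul1n.
have : \sum_(y : F) y ^+ N = \sum_(y : F) (w * y) ^+ N.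
  by rewrite (reindex_inj (mulfI w0)).
rewrite [RHS](eq_bigr (fun y => w ^+ N * y ^+ N)); last by move=> y _; rewrite exprMn.
rewrite -big_distrr /= oppr0 => /eqP.
by rewrite -[X in X == _]mul1r -subr_eq0 -mulrBl mulf_eq0 subr_eq0 eq_sym (negPf wN) => /eqP.
Qed.

(** Expand the power binomially: by [sum_expr] only the exponent [2 * (e - i) + 2 * j = 2 * e]
    survives, that is, [i = j]. The bound on [j] keeps all exponents in the range of [sum_expr]. *)
Lemma sum_quad_even (s : F) (j : nat) : (j < e)%N ->
  \sum_(y : F) (y ^+ 2 - s ^+ 2) ^+ e * y ^+ j.*2 =
  - ('C(e, j)%:R * (- s ^+ 2) ^+ j).
Proof.
move=> ltje.
under eq_bigr => y _.
  rewrite exprDn big_distrl /=.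
  under eq_bigr => i _.
    rewrite (_ : _ * _ = 'C(e, i)%:R * (- s ^+ 2) ^+ i * y ^+ (2 * (e - i) + j.*2)).
      over.
    by rewrite -mulr_natl exprD exprM; ring.
  over.
rewrite exchange_big /=.
have lti (i : 'I_e.+1) : (2 * (e - i) + j.*2 < e.*2.*2)%N.
  by move: (ltn_ord i) ltje; lia.
under eq_bigr => i _ do rewrite -big_distrr /= (sum_expr (lti i)).
rewrite (bigD1 (Ordinal (ltnW ltje : j < e.+1)%N)) //= big1 => [|i nij].
  rewrite addr0 (_ : _ == _ = true) ?mulrN1 //; apply/eqP; lia.
rewrite (_ : _ == _ = false) ?oppr0 ?mulr0 //; apply: contraNF nij => /eqP ij.
by apply/eqP/val_inj => /=; move: (ltn_ord i); lia.
Qed.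

Lemma sum_quad_odd (s : F) (i : nat) : odd i ->
  \sum_(y : F) (y ^+ 2 - s ^+ 2) ^+ e * y ^+ i = 0.
Proof.
move=> oddi; set S := LHS; have SN : S = - S.
  rewrite {1}/S (reindex_inj oppr_inj) /= -sumrN; apply: eq_bigr => y _.
  by rewrite sqrrN exprNn -signr_odd oddi expr1 mulN1r mulrN.
apply: (mulfI two_neq0); rewrite mulr0 mulr_natl mulr2n.
by rewrite {2}SN subrr.
Qed.

(** * The base block and its power sums *)

Section BaseBlock.

Variable tau : F.
Hypothesis tau0 : tau != 0.

Local Notation B := (base_block tau).

Lemma in_base_block (x : F) : (x \in B) = (x \in Q) (+) (x - tau \in Q).
Proof.
have shiftE : (x \in [set y + tau | y in Q]) = (x - tau \in Q).
  apply/imsetP/idP => [[y yQ ->]|xQ]; first by rewrite addrK.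
  by exists (x - tau); rewrite ?subrK.
by rewrite in_setU !in_setD shiftE; case: (x \in Q); case: (x - tau \in Q).
Qed.

(** The quadratic character is multiplicative: exactly one of two nonzero elements is a square iff
    their product is a nonsquare. *)
Lemma in_base_block_quad (x : F) : x != 0 -> x != tau ->
  (x \in B) = (x * (x - tau) \notin Q).
Proof.
move=> x0; rewrite -subr_eq0 => xt.
rewrite in_base_block !euler_criterion exprMn.
have n1 := negPf opp1_neq1; have n2 := n1; rewrite eq_sym in n2.
by case/orP: (expf_half_sqr1 x0) => /eqP ->; case/orP: (expf_half_sqr1 xt) => /eqP ->;
  rewrite ?mulN1r ?mul1r ?opprK ?n1 ?n2 ?eqxx.
Qed.

Lemma zero_in_base_block : (0 \in B) = ((-1) ^+ e * tau ^+ e == 1).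
Proof.
rewrite in_base_block !euler_criterion sub0r (exprNn tau) expr0n gtn_eqF ?half_gt0 //.
by rewrite [0 == 1]eq_sym oner_eq0.
Qed.

Lemma tau_in_base_block : (tau \in B) = (tau ^+ e == 1).
Proof.
rewrite in_base_block !euler_criterion subrr expr0n gtn_eqF ?half_gt0 //.
by rewrite [0 == 1]eq_sym oner_eq0 addbF.
Qed.

(** With [u = 1 - tau / x] one has [x * (x - tau) = x ^+ 2 * u], so away from 0 and [tau] membership
    in the block means that [u] is a nonsquare. The value [u = 1], which no [x] attains, is a square
    and does not disturb the count. *)
Lemma card_base_block : #|B| = (e + (0%R \in B) + (tau \in B))%N.
Proof.
rewrite (cardsD1 0) (cardsD1 tau (B :\ 0)) in_setD1 tau0 /=.
suff -> : #|B :\ 0 :\ tau| = e by rewrite addnA addnC addnA.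
rewrite -[RHS]card_nonzero_nonsquares.
have -> : B :\ 0 :\ tau = [set tau / (1 - u) | u in [set u | (u != 0) && (u \notin Q)]].
  apply/setP => x; apply/idP/imsetP => [|[u]].
    rewrite !in_setD1 => /and3P[xt x0 xB].
    have uE : 1 - tau / x = (x * (x - tau)) / (x ^+ 2) by field.
    exists (1 - tau / x); last by field; rewrite x0 opprB addrC subrK.
    move: xB; rewrite in_base_block_quad // euler_criterion => nQ; rewrite in_set.
    rewrite uE mulf_neq0 ?mulf_neq0 ?invr_eq0 ?expf_neq0 ?subr_eq0 //=.
    by rewrite euler_criterion exprMn exprVn -exprM mul2n expf_double_half // divr1.
  rewrite inE => /andP[u0 uQ ->].
  have u1 : 1 - u != 0.
    rewrite subr_eq0; apply: contraNneq uQ => <-.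
    by rewrite euler_criterion expr1n.
  have x0 : tau / (1 - u) != 0 by rewrite mulf_neq0 ?invr_eq0.
  have xt : tau / (1 - u) - tau = tau / (1 - u) * u by field.
  have xt0 : tau / (1 - u) != tau by rewrite -subr_eq0 xt mulf_neq0.
  rewrite !in_setD1 x0 xt0 /= in_base_block_quad // xt mulrA -expr2.
  rewrite euler_criterion exprMn -exprM mul2n expf_double_half // mul1r.
  by rewrite -euler_criterion.
rewrite card_in_imset // => u v; rewrite !inE => /andP[u0 uQ] /andP[v0 vQ].
by move/(mulfI tau0)/invr_inj/addrI/oppr_inj.
Qed.

(** The last two terms correct the formula at 0 and [tau], where the power vanishes and the main
    part would give 1. *)
Lemma base_block_indicator (x : F) :
  2%:R * (x \in B)%:R = 1 - (x * (x - tau)) ^+ e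
    + (2%:R * (0 \in B)%:R - 1) * (x == 0)%:R
    + (2%:R * (tau \in B)%:R - 1) * (x == tau)%:R.
Proof.
have [->|x0] := eqVneq x 0.
  by rewrite mul0r expr0n gtn_eqF ?half_gt0 // [0 == tau]eq_sym (negPf tau0) /=; ring.
have [->|xt] := eqVneq x tau.
  by rewrite subrr mulr0 expr0n gtn_eqF ?half_gt0 //=; ring.
have : x * (x - tau) != 0 by rewrite mulf_neq0 ?subr_eq0.
rewrite in_base_block_quad // euler_criterion.
by case/expf_half_sqr1/orP => /eqP ->; rewrite ?eqxx ?(negPf opp1_neq1) /=; ring.
Qed.

(** Centring at the midpoint of 0 and [tau] turns [x * (x - tau)] into the even polynomial
    [y ^+ 2 - (tau / 2) ^+ 2]. *)
Definition block_moment (i : nat) : F := \sum_(x in B) (x - tau / 2%:R) ^+ i.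

(** Sum [base_block_indicator] against the power of [y = x - tau / 2]. Its constant term contributes
    nothing, since the sum of [y ^+ i] is zero for [i < q - 1]; the points 0 and [tau] sit at
    [y = - tau / 2] and [y = tau / 2]. *)
Lemma block_momentE (i : nat) : (i < e.*2)%N ->
  2%:R * block_moment i =
    - (\sum_(y : F) (y ^+ 2 - (tau / 2%:R) ^+ 2) ^+ e * y ^+ i)
    + (2%:R * (0 \in B)%:R - 1) * (- (tau / 2%:R)) ^+ i
    + (2%:R * (tau \in B)%:R - 1) * (tau / 2%:R) ^+ i.
Proof.
move=> lti; have n2 := two_neq0.
pose s := tau / 2%:R.
transitivity (\sum_(x : F) (2%:R * (x \in B)%:R) * (x - s) ^+ i).
  rewrite /block_moment big_distrr /= big_mkcond /=; apply: eq_bigr => x _.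
  by case: (x \in B); rewrite ?mulr1 // mulr0 mul0r.
have delta a (c : F) : \sum_(x : F) c * (x == a)%:R * (x - s) ^+ i = c * (a - s) ^+ i.
  rewrite (bigD1 a) //= eqxx mulr1 big1 ?addr0 // => x /negPf ->.
  by rewrite mulr0 mul0r.
under eq_bigr => x _ do rewrite base_block_indicator 2!mulrDl.
rewrite 2!big_split /= !delta sub0r (_ : tau - s = s); last by rewrite /s; field.
congr (_ + _ + _).
rewrite (reindex_inj (addIr s)) /=.
under eq_bigr => y _.
  rewrite addrK mulrBl mul1r (_ : (y + s) * _ = y ^+ 2 - s ^+ 2); last by rewrite /s; field.
  over.
rewrite big_split /= sumrN sum_expr; last by lia.
by rewrite ltn_eqF // oppr0 add0r.
Qed.

Lemma two_indicator_sqr (x : F) : x != 0 ->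
  2%:R * (x ^+ e == 1)%:R - 1 = x ^+ e.
Proof.
by case/expf_half_sqr1/orP => /eqP ->; rewrite ?eqxx ?(negPf opp1_neq1) /=; ring.
Qed.

Lemma block_moment_even (j : nat) : (j < e)%N ->
  2%:R * block_moment j.*2 =
    'C(e, j)%:R * (- (tau / 2%:R) ^+ 2) ^+ j
    + (1 + (-1) ^+ e) * tau ^+ e * (tau / 2%:R) ^+ j.*2.
Proof.
move=> ltje; rewrite block_momentE ?ltn_double // sum_quad_even // opprK.
rewrite zero_in_base_block tau_in_base_block two_indicator_sqr //.
rewrite -exprNn two_indicator_sqr ?oppr_eq0 // (exprNn tau) (exprNn (tau / 2%:R)).
by rewrite -(signr_odd _ j.*2) odd_double expr0; ring.
Qed.

Lemma block_moment_odd (i : nat) : odd i -> (i < e.*2)%N ->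
  2%:R * block_moment i = (1 - (-1) ^+ e) * tau ^+ e * (tau / 2%:R) ^+ i.
Proof.
move=> oddi lti; rewrite block_momentE // sum_quad_odd // oppr0.
rewrite zero_in_base_block tau_in_base_block two_indicator_sqr //.
rewrite -exprNn two_indicator_sqr ?oppr_eq0 // (exprNn tau) (exprNn (tau / 2%:R)).
by rewrite -(signr_odd _ i) oddi expr1; ring.
Qed.

End BaseBlock.

(* As [2 * e = -1] in [F], this is the recursion of the coefficients C(-1/2, j). *)
Lemma bin_half_rec (j : nat) :
  (2 * j.+1)%:R * 'C(e, j.+1)%:R = - (2 * j + 1)%:R * 'C(e, j)%:R :> F.
Proof.
have e2 : 2%:R * e%:R = -1 :> F.
  apply/eqP; rewrite -addr_eq0 -natrM natr1 mul2n -cardF.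
  by rewrite natr_card_finField.
have [leje|ltej] := leqP j e; last by rewrite !bin_small ?mulr0 // ltnW.
rewrite natrM -mulrA -natrM mul_bin_left natrM natrB // mulrA mulrBr e2.
by rewrite natrD natrM; ring.
Qed.

End OddFiniteField.

(** * The stabiliser of the base block *)

Lemma sum_affine_expr (R : comNzRingType) (I : finType) (X : {set I}) (f : I -> R)
    (a d : R) (i : nat) :
  \sum_(x in X) (d + a * f x) ^+ i =
  \sum_(j < i.+1) d ^+ (i - j) * a ^+ j * 'C(i, j)%:R * \sum_(x in X) f x ^+ j.
Proof.
under eq_bigr => x _ do rewrite exprDn.
rewrite exchange_big /=; apply: eq_bigr => j _; rewrite big_distrr /=.
by apply: eq_bigr => x _; rewrite -mulr_natr exprMn; ring.
Qed.

Lemma sum_affine_fixed (F : finFieldType) (V : nmodType) (X : {set F}) (a b : F) (h : F -> V) :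
  a != 0 -> [set a * x + b | x in X] = X ->
  \sum_(x in X) h (a * x + b) = \sum_(x in X) h x.
Proof.
move=> a0 fixX; rewrite -[in RHS]fixX big_imset //.
by move=> x y _ _ /addIr/(mulfI a0).
Qed.

(** Summing [x - c] over the image of [X] gives [#|X|] times the displacement [a * c + b - c] of the
    centroid. *)
Lemma centroid_fixed (F : finFieldType) (X : {set F}) (a b c : F) :
  #|X|%:R != 0 :> F -> \sum_(x in X) (x - c) = 0 ->
  a != 0 -> [set a * x + b | x in X] = X -> a * c + b = c.
Proof.
move=> X0 sum0 a0 fixX; have := sum_affine_fixed (fun x => x - c) a0 fixX.
rewrite sum0 (eq_bigr (fun x => a * (x - c) + (a * c + b - c))) => [|x _]; last by ring.
rewrite big_split /= -big_distrr /= sum0 mulr0 add0r sumr_const -mulr_natr.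
by move/eqP; rewrite mulf_eq0 (negPf X0) orbF subr_eq0 => /eqP.
Qed.

(** A map fixing [c] multiplies each [x - c] by [a], hence the moment by [a ^+ i]. *)
Lemma central_moment_fixed (F : finFieldType) (X : {set F}) (a b c : F) (i : nat) :
  a != 0 -> [set a * x + b | x in X] = X -> a * c + b = c ->
  \sum_(x in X) (x - c) ^+ i != 0 -> a ^+ i = 1.
Proof.
move=> a0 fixX fixc mu0; have := sum_affine_fixed (fun x => (x - c) ^+ i) a0 fixX.
rewrite (eq_bigr (fun x => a ^+ i * (x - c) ^+ i)) => [|x _].
  by rewrite -big_distrr /= => /eqP; rewrite -subr_eq0 -{2}[\sum_(x in X) _]mul1r -mulrBl
     mulf_eq0 (negPf mu0) orbF subr_eq0 => /eqP.
by rewrite -exprMn; congr (_ ^+ _); rewrite -{1}fixc; ring.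
Qed.

(** Unrolls a sum of known length and evaluates its binomials and index differences, so that [ring]
    and [field] meet only numerals. *)
Ltac expand_ord_sum :=
  rewrite ?big_ord_recr big_ord0 /=;
  repeat match goal with
  | |- context [binomial ?n ?k] =>
    let v := eval vm_compute in (binomial n k) in change (binomial n k) with v
  | |- context [subn ?n ?k] =>
    let v := eval vm_compute in (subn n k) in change (subn n k) with v
  end; rewrite /=.

(** The factors 6 and 10 stay on the left because 3 or 5 may vanish in [F]. *)
Lemma binomial_half (F : finFieldType) (e : nat) : #|F| = e.*2.+1 ->
  [/\ 'C(e, 1)%:R = - (1 / 2%:R) :> F, 'C(e, 2)%:R = 3%:R / 8%:R :> F,
      6%:R * 'C(e, 3)%:R = - (15%:R / 8%:R) :> F,
      8%:R * 'C(e, 4)%:R = - (7%:R * 'C(e, 3)%:R) :> F &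
      10%:R * 'C(e, 5)%:R = - (9%:R * 'C(e, 4)%:R) :> F].
Proof.
move=> cardF; have n2 := two_neq0 cardF; have rec := bin_half_rec cardF.
have n4 : 4%:R != 0 :> F by rewrite (natrM F 2 2) mulf_neq0.
have n8 : 8%:R != 0 :> F by rewrite (natrM F 2 4) mulf_neq0.
have c1 : 'C(e, 1)%:R = - (1 / 2%:R) :> F.
  apply: (mulfI n2); have := rec 0; rewrite bin0 /= => ->.
  by field.
have c2 : 'C(e, 2)%:R = 3%:R / 8%:R :> F.
  by apply: (mulfI n4); have := rec 1%N; rewrite c1 /= => ->; field; rewrite ?n2 ?n4 ?n8.
split=> //.
- by have := rec 2%N; rewrite c2 /= => ->; field; rewrite ?n2 ?n4 ?n8.
- by have := rec 3%N; rewrite /= => ->; ring.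
- by have := rec 4%N; rewrite /= => ->; ring.
Qed.

(** The centroid exists, so only [a] is in question. Two central moments of coprime degrees are
    nonzero: degrees 3 and 8 in characteristic 7, 2 and 5 in characteristic 3, and 2 and 3
    otherwise. The bound on [e] makes the moments up to degree 8 available. *)
Lemma base_block_stabilizer_odd (F : finFieldType) (e : nat) (tau a b : F) :
  #|F| = e.*2.+1 -> odd e -> (4 < e)%N -> tau != 0 -> a != 0 ->
  [set a * x + b | x in base_block tau] = base_block tau -> a = 1 /\ b = 0.
Proof.
move=> cardF odde lt4e tau0 a0 fixB.
have n2 := two_neq0 cardF.
(* The sign [eps] is absorbed into [u]: even powers of [s] and [u] agree, and the odd moments become
   [2 * u ^+ i]. *)
pose s := tau / 2%:R; pose eps := tau ^+ e; pose u := eps * s.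
have eps2 : eps ^+ 2 = 1 by rewrite -exprM muln2 (expf_double_half cardF).
have u0 : u != 0 by rewrite !mulf_neq0 ?invr_eq0 ?expf_neq0.
have s2 : s ^+ 2 = u ^+ 2 by rewrite [u ^+ 2]exprMn eps2 mul1r.
pose m i := 2%:R * block_moment tau i.
have mo i : odd i -> (i < 10)%N -> m i = 2%:R * u ^+ i.
  move=> oi li; rewrite /m (block_moment_odd cardF) //; last by lia.
  have epsi : eps ^+ i = eps.
    by rewrite -(odd_double_half i) oi exprS -mul2n exprM eps2 expr1n mulr1.
  by rewrite -signr_odd odde [u ^+ i]exprMn epsi -/eps -/s; ring.
have me j : (j < 5)%N -> m j.*2 = 'C(e, j)%:R * (- u ^+ 2) ^+ j.
  move=> li; rewrite /m (block_moment_even cardF) //; last by lia.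
  by rewrite -signr_odd odde expr1 -/s s2 subrr !mul0r addr0.
have central i : 2%:R * \sum_(x in base_block tau) (x - (s + 2%:R * u)) ^+ i =
   \sum_(j < i.+1) (- (2%:R * u)) ^+ (i - j) * 'C(i, j)%:R * m j.
  rewrite (eq_bigr (fun x => (- (2%:R * u) + 1 * (x - s)) ^+ i)); last first.
    by move=> x _; congr (_ ^+ _); ring.
  rewrite sum_affine_expr big_distrr; apply: eq_bigr => j _.
  by rewrite /m /block_moment expr1n -/s /=; ring.
have n4 : 4%:R != 0 :> F by rewrite (natrM F 2 2) mulf_neq0.
have n8 : 8%:R != 0 :> F by rewrite (natrM F 2 4) mulf_neq0.
have [c1 c2 c3 c4 _] := binomial_half cardF.
have m0 : m 0%N = 1 by have := me 0 isT; rewrite bin0 mulr1.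
have m1 : m 1%N = 2%:R * u by have := mo 1%N isT isT; rewrite expr1.
have m2 : m 2%N = u ^+ 2 / 2%:R.
  by have := me 1%N isT; rewrite c1 /= => ->; field; rewrite ?n2 ?n4 ?n8.
have m3 := mo 3%N isT isT.
have m4 : m 4%N = 3%:R / 8%:R * u ^+ 4.
  by have := me 2%N isT; rewrite c2 /= => ->; field; rewrite ?n2 ?n4 ?n8.
have m5 := mo 5%N isT isT.
have m6 : m 6%N = - 'C(e, 3)%:R * u ^+ 6.
  by have := me 3%N isT; rewrite /= => ->; ring.
have m7 := mo 7%N isT isT.
have m8 : m 8%N = 'C(e, 4)%:R * u ^+ 8.
  by have := me 4%N isT; rewrite /= => ->; ring.
(* The centroid of the block is [s + 2 * u]. *)
pose mu i := \sum_(x in base_block tau) (x - (s + 2%:R * u)) ^+ i.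
have mu1 : 2%:R * mu 1%N = 0 by rewrite /mu central; expand_ord_sum; rewrite m0 m1; ring.
have mu2 : 2%:R * mu 2%N = 7%:R * (- (u ^+ 2 / 2%:R)).
  by rewrite /mu central; expand_ord_sum; rewrite m0 m1 m2; field; rewrite ?n2 ?n4 ?n8.
have mu3 : 2%:R * mu 3%N = 15%:R * u ^+ 3.
  by rewrite /mu central; expand_ord_sum; rewrite m0 m1 m2 m3; field; rewrite ?n2 ?n4 ?n8.
have mu5 : 2%:R * mu 5%N = 665%:R * (u ^+ 5 / 4%:R).
  by rewrite /mu central; expand_ord_sum; rewrite m0 m1 m2 m3 m4 m5; field; rewrite ?n2 ?n4 ?n8.
(* Needed in characteristic 7, so a multiple of 7 is split off. *)
have mu8 : 2%:R * mu 8%N = 7%:R * (- 712%:R - 16%:R * 'C(e, 3)%:R) * u ^+ 8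
    + ('C(e, 4)%:R - 4%:R) * u ^+ 8.
  by rewrite /mu central; expand_ord_sum; rewrite m0 m1 m2 m3 m4 m5 m6 m7 m8; field; rewrite ?n2 ?n4 ?n8.
(* In [F], [m 0 = 1] is twice the block size. *)
have cardB : #|base_block tau|%:R != 0 :> F.
  have := m0; rewrite /m /block_moment (eq_bigr (fun=> 1)) => [|x _]; last exact: expr0.
  rewrite sumr_const => cB; apply: contra_eq_neq cB => ->.
  by rewrite mulr0 eq_sym oner_eq0.
have fixc : a * (s + 2%:R * u) + b = s + 2%:R * u.
  apply: (centroid_fixed cardB _ a0 fixB); apply: (mulfI n2); rewrite mulr0 -[RHS]mu1.
  by congr (_ * _); apply: eq_bigr => x _; rewrite expr1.
have pow i : 2%:R * mu i != 0 -> a ^+ i = 1.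
  rewrite mulf_eq0 negb_or => /andP[_]; exact: (central_moment_fixed a0 fixB fixc).
suff a1 : a = 1.
  by split=> //; move: fixc; rewrite a1 mul1r addrC -[RHS]add0r => /addIr.
have neg1 := opp1_neq1 cardF.
(* In characteristic 5, -1 = 2 ^ 2 would be a square. *)
have n5 : 5%:R != 0 :> F.
  apply: contra neg1 => /eqP z5.
  have : (2%:R : F) ^+ 2 = - 1 by rewrite -[LHS](addrK 1) -[X in _ = X]add0r -z5; ring.
  move/(congr1 (fun x => x ^+ e)); rewrite /= -exprM mul2n (expf_double_half cardF) //.
  by rewrite -signr_odd odde expr1 => <-.
have [z7|n7] := eqVneq (7%:R : F) 0.
  have a3 : a ^+ 3 = 1.
    apply: pow; rewrite mu3 (_ : 15%:R = 2%:R * 7%:R + 1); last by ring.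
    by rewrite z7 mulr0 add0r mul1r expf_neq0.
  have a8 : a ^+ 8 = 1.
    apply: pow; have -> : 2%:R * mu 8%N = - 4%:R * u ^+ 8.
      rewrite mu8 z7 mul0r mul0r add0r; congr (_ * _).
      suff -> : 'C(e, 4)%:R = 0 :> F by rewrite sub0r.
      by apply: (mulfI n8); rewrite c4 z7 mul0r mulr0 oppr0.
    by rewrite mulf_neq0 ?oppr_eq0 ?expf_neq0.
  by rewrite -[LHS]mulr1 -a8 -exprS (exprM a 3 3) a3 expr1n.
have a2 : a ^+ 2 = 1.
  by apply: pow; rewrite mu2 mulf_neq0 ?oppr_eq0 ?mulf_neq0 ?invr_eq0 ?expf_neq0.
have [z3|n3] := eqVneq (3%:R : F) 0.
  have a5 : a ^+ 5 = 1.
    apply: pow; rewrite mu5 (_ : 665%:R = 222%:R * 3%:R - 1); last by ring.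
    by rewrite z3 mulr0 add0r mulN1r oppr_eq0 mulf_neq0 ?invr_eq0 ?expf_neq0.
  by move: a5; rewrite exprS (exprM a 2 2) a2 expr1n mulr1.
have a3 : a ^+ 3 = 1.
  by apply: pow; rewrite mu3 (natrM F 3 5) mulf_neq0 ?(mulf_neq0 n3 n5) ?expf_neq0.
by move: a3; rewrite exprS a2 mulr1.
Qed.

(** It suffices that the midpoint [s] of 0 and [tau] is fixed and that [a ^+ 2 = 1]: with [a = -1]
    this is the reflection in [s]. The bound on [e] gives access to the moments up to degree 11. *)
Lemma base_block_stabilizer_even (F : finFieldType) (e : nat) (tau a b : F) :
  #|F| = e.*2.+1 -> ~~ odd e -> (5 < e)%N -> tau != 0 -> a != 0 ->
  [set a * x + b | x in base_block tau] = base_block tau ->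
  a = 1 /\ b = 0 \/ a = -1 /\ b = tau.
Proof.
move=> cardF evene lt5e tau0 a0 fixB.
have n2 := two_neq0 cardF.
have n4 : 4%:R != 0 :> F by rewrite (natrM F 2 2) mulf_neq0.
have n8 : 8%:R != 0 :> F by rewrite (natrM F 2 4) mulf_neq0.
pose s := tau / 2%:R; pose eps := tau ^+ e.
have s0 : s != 0 by rewrite mulf_neq0 ?invr_eq0.
have tauE : tau = 2%:R * s by rewrite /s; field.
pose m i := 2%:R * block_moment tau i.
have mo i : odd i -> (i < 12)%N -> m i = 0.
  move=> oi li; rewrite /m (block_moment_odd cardF) //; last by lia.
  by rewrite -signr_odd (negPf evene) expr0 subrr !mul0r.
have me j : (j < 6)%N -> m j.*2 = ((-1) ^+ j * 'C(e, j)%:R + 2%:R * eps) * s ^+ j.*2.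
  move=> li; rewrite /m (block_moment_even cardF) //; last by lia.
  rewrite -(signr_odd _ e) (negPf evene) expr0 -/s -/eps (exprNn (s ^+ 2)) -exprM mul2n.
  by ring.
have affine d i : 2%:R * \sum_(x in base_block tau) (d + a * (x - s)) ^+ i =
   \sum_(j < i.+1) d ^+ (i - j) * a ^+ j * 'C(i, j)%:R * m j.
  rewrite sum_affine_expr big_distrr; apply: eq_bigr => j _.
  by rewrite /m /block_moment -/s /=; ring.
have [c1 c2 c3 c4 c5] := binomial_half cardF.
have m0 : m 0%N = 1 + 2%:R * eps.
  by have := me 0 isT; rewrite bin0 /= => ->; ring.
have m2 : m 2%N = (1 / 2%:R + 2%:R * eps) * s ^+ 2.
  by have := me 1%N isT; rewrite c1 /= => ->; ring.
have m4 : m 4%N = (3%:R / 8%:R + 2%:R * eps) * s ^+ 4.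
  by have := me 2%N isT; rewrite c2 /= => ->; ring.
have m6 : m 6%N = (- 'C(e, 3)%:R + 2%:R * eps) * s ^+ 6.
  by have := me 3%N isT; rewrite /= => ->; ring.
have m10 : m 10%N = (- 'C(e, 5)%:R + 2%:R * eps) * s ^+ 10.
  by have := me 5%N isT; rewrite /= => ->; ring.
have m1 := mo 1%N isT isT; have m3 := mo 3%N isT isT; have m5 := mo 5%N isT isT.
have m7 := mo 7%N isT isT; have m9 := mo 9%N isT isT; have m11 := mo 11%N isT isT.
have cardB : m 0%N = 2%:R * #|base_block tau|%:R.
  rewrite /m /block_moment (eq_bigr (fun=> 1)) => [|x _]; last exact: expr0.
  by rewrite sumr_const.
suff [a2 fixs] : a ^+ 2 = 1 /\ a * s + b = s.
  have bE : b = a * s + b - a * s by ring.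
  rewrite fixs in bE.
  move/eqP: a2; rewrite sqrf_eq1 => /orP[] /eqP aE; [left | right];
    by rewrite bE aE ?tauE; split=> //; ring.
have fixm i : \sum_(x in base_block tau) (a * s + b - s + a * (x - s)) ^+ i = block_moment tau i.
  rewrite /block_moment -(sum_affine_fixed (fun x => (x - tau / 2%:R) ^+ i) a0 fixB).
  by apply: eq_bigr => x _; congr (_ ^+ _); rewrite -/s; ring.
have pow i : a * s + b = s -> m i != 0 -> a ^+ i = 1.
  move=> fixs; rewrite mulf_eq0 negb_or => /andP[_].
  exact: (central_moment_fixed a0 fixB fixs).
have fixs : m 0%N != 0 -> a * s + b = s.
  rewrite cardB mulf_eq0 negb_or => /andP[_ B0].
  apply: (centroid_fixed B0 _ a0 fixB); apply: (mulfI n2); rewrite mulr0 -[RHS]m1.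
  by congr (_ * _); apply: eq_bigr => x _; rewrite expr1.
have neps : eps = 1 \/ eps = -1.
  by case/orP: (expf_half_sqr1 cardF tau0) => /eqP epsE; [left | right].
(* In characteristic 3 the relation [10 * C(e, 5) = - 9 * C(e, 4)] reads [C(e, 5) = 0]. *)
have c5z : 3%:R = 0 :> F -> 'C(e, 5)%:R = 0 :> F.
  move=> z3; transitivity (10%:R * 'C(e, 5)%:R - 3%:R * (3%:R * 'C(e, 5)%:R) : F).
    by ring.
  by rewrite c5 (natrM F 3 3) z3 !mul0r oppr0 addr0.
(* First [eps = -1], where [m 0 = -1] and the centroid always exists. The second moment is a nonzero
   multiple of 3; in characteristic 3, degrees 4 and 10 replace it. *)
case: neps => epsE; rewrite epsE in m0 m2 m4 m6 m10; last first.
  have fs : a * s + b = s by apply: fixs; rewrite m0 (_ : _ + _ = -1) ?oppr_eq0 ?oner_neq0 //; ring.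
  split=> //; have [z3|n3] := eqVneq (3%:R : F) 0; last first.
    apply: pow => //; have -> : m 2%N = - 3%:R * (s ^+ 2 / 2%:R) by rewrite m2; field.
    by rewrite mulf_neq0 ?oppr_eq0 // mulf_neq0 ?invr_eq0 ?(expf_neq0 _ s0).
  have a4 : a ^+ 4 = 1.
    apply: pow => //; rewrite m4 z3 mul0r add0r mulrN1.
    by rewrite mulf_neq0 ?oppr_eq0 ?(expf_neq0 _ s0).
  have a10 : a ^+ 10 = 1.
    apply: pow => //; rewrite m10 (c5z z3) oppr0 add0r mulrN1.
    by rewrite mulf_neq0 ?oppr_eq0 ?(expf_neq0 _ s0).
  by move: a10; rewrite (exprD a 8 2) (exprM a 4 2) a4 expr1n mul1r.
(* Now [eps = 1] and [m 0 = 3]. Outside characteristic 3 there is a centroid, and the second moment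
   is a multiple of 5; in characteristic 5, degrees 4 and 6 replace it. *)
have [z3|n3] := eqVneq (3%:R : F) 0; last first.
  have fs : a * s + b = s by apply: fixs; rewrite m0 (_ : _ + _ = 3%:R) //; ring.
  split=> //; have [z5|n5] := eqVneq (5%:R : F) 0; last first.
    apply: pow => //; have -> : m 2%N = 5%:R * (s ^+ 2 / 2%:R) by rewrite m2; field.
    by rewrite mulf_neq0 // mulf_neq0 ?invr_eq0 ?(expf_neq0 _ s0).
  have c3z : 'C(e, 3)%:R = 0 :> F.
    have n6 : 6%:R != 0 :> F by rewrite (natrM F 2 3) mulf_neq0.
    by apply: (mulfI n6); rewrite c3 (natrM F 5 3) z5 !mul0r oppr0 mulr0.
  have a4 : a ^+ 4 = 1.
    apply: pow => //.
    have -> : m 4%N = (4%:R * 5%:R - 1) * (s ^+ 4 / 8%:R).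
      by rewrite m4; field; rewrite ?n2 ?n4 ?n8.
    by rewrite z5 mulr0 add0r mulN1r oppr_eq0 mulf_neq0 ?invr_eq0 ?(expf_neq0 _ s0).
  have a6 : a ^+ 6 = 1.
    by apply: pow => //; rewrite m6 c3z oppr0 add0r mulr1 mulf_neq0 ?(expf_neq0 _ s0).
  by move: a6; rewrite (exprD a 4 2) a4 mul1r.
have m0z : m 0%N = 0 by rewrite m0 -[RHS]z3; ring.
have m2E : m 2%N = s ^+ 2.
  rewrite (_ : m 2%N = (1 + 3%:R / 2%:R) * s ^+ 2); last by rewrite m2; field.
  by rewrite z3 mul0r addr0 mul1r.
have m4E : m 4%N = 2%:R * s ^+ 4 by rewrite m4 z3 mul0r add0r mulr1.
have m10E : m 10%N = 2%:R * s ^+ 10.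
  by rewrite m10 (c5z z3) oppr0 add0r mulr1.
(* Without a centroid [s] might move; [d] is its displacement, to be shown zero. *)
set d := a * s + b - s in fixm.
have inv i : \sum_(j < i.+1) d ^+ (i - j) * a ^+ j * 'C(i, j)%:R * m j = m i.
  by rewrite -affine fixm.
have a2 : a ^+ 2 = 1.
  have := inv 2%N; expand_ord_sum; rewrite m0z m1 m2E !mulr0 !add0r !mulr1 expr0 mul1r.
  by rewrite -[X in _ = X -> _]mul1r; apply: mulIf; rewrite expf_neq0.
have [d0|dn0] := eqVneq d 0.
  by split=> //; apply/eqP; rewrite -subr_eq0 -/d d0.
have n5 : 5%:R != 0 :> F.
  have -> : 5%:R = 2%:R * 3%:R - 1 :> F by ring.
  by rewrite z3 mulr0 add0r oppr_eq0 oner_neq0.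
(* The identity of degree 5 is [10 * d * s ^+ 2 * (d ^+ 2 + s ^+ 2) = 0]. *)
have d2 : d ^+ 2 = - s ^+ 2.
  have := inv 5%N; expand_ord_sum; rewrite m0z m1 m2E m3 m4E m5.
  rewrite (exprM a 2 2) a2 => inv5.
  have nz := mulf_neq0 n5 (mulf_neq0 n2 (mulf_neq0 dn0 (expf_neq0 2 s0))).
  apply/eqP; rewrite -addr_eq0; apply/eqP/(mulfI nz).
  by rewrite mulr0 -[RHS]inv5; ring.
(* With [d ^+ 9 = d * s ^+ 8], the terms of [m 2] and [m 10] in degree 11 add up to
   [77 * d * s ^+ 10], and [77 = 2 + 3 * 25]. *)
suff : (2%:R * (d * s ^+ 10)) = 0.
  have nz := mulf_neq0 n2 (mulf_neq0 dn0 (expf_neq0 10 s0)).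
  by move/eqP; rewrite (negPf nz).
have := inv 11%N; expand_ord_sum; rewrite m0z m1 m2E m3 m4E m5 m7 m9 m10E m11.
rewrite (exprSr d 8) (exprM d 2 4) d2.
rewrite (exprM a 2 5) a2 => inv11.
(* [m 6] and [m 8], whose values are unknown, only enter with coefficients
   divisible by 3. *)
pose W := 25%:R * d * s ^+ 10 + 220%:R * d ^+ 7 * a ^+ 4 * s ^+ 4
  + 154%:R * d ^+ 5 * a ^+ 6 * m 6%N + 55%:R * d ^+ 3 * a ^+ 8 * m 8%N.
transitivity (0 - 3%:R * W); last by rewrite z3 mul0r subr0.
by rewrite -[X in X - _]inv11 /W; ring.
Qed.

(** * Counting blocks *)

(* A pair [(a, b)] stands for the map [x |-> a * x + b]. *)
Definition affine_image (F : finFieldType) (g : F * F) (X : {set F}) : {set F} :=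
  [set g.1 * x + g.2 | x in X].

Definition affine_group (F : finFieldType) : {set F * F} := [set g | g.1 != 0].

Definition affine_stabilizer (F : finFieldType) (X : {set F}) : {set F * F} :=
  [set g in affine_group F | affine_image g X == X].

Lemma GA1_blocksE (F : finFieldType) (X : {set F}) :
  GA1_blocks X = [set affine_image g X | g in affine_group F].
Proof.
apply/setP => Y; apply/imsetP/imsetP => [[f]|[[a b]]]; rewrite inE.
  case/existsP => a /existsP[b /andP[a0 /eqP ->]] ->; exists (a, b); rewrite ?inE //.
  by apply: eq_imset => x; rewrite ffunE.
move=> /= a0 ->; exists [ffun x => a * x + b].
  by rewrite inE; apply/existsP; exists a; apply/existsP; exists b; rewrite a0 eqxx.
by apply: eq_imset => x; rewrite ffunE.
Qed.

Lemma mem_affine_image (F : finFieldType) (g : F * F) (X : {set F}) (y : F) :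
  g.1 != 0 -> (y \in affine_image g X) = ((y - g.2) / g.1 \in X).
Proof.
move=> a0; apply/imsetP/idP => [[x xX ->]|yX].
  by rewrite addrK mulrC mulKf.
by exists ((y - g.2) / g.1) => //; field.
Qed.

(** The fibre is the left coset of the stabiliser through [g]; [comp] is composition of maps,
    written on pairs. *)
Lemma card_affine_image_fiber (F : finFieldType) (X : {set F}) (g : F * F) :
  g \in affine_group F ->
  #|[set h in affine_group F | affine_image h X == affine_image g X]| = #|affine_stabilizer X|.
Proof.
rewrite inE => a0.
pose comp (g h : F * F) := (g.1 * h.1, g.1 * h.2 + g.2).
have compE g' h Y : affine_image (comp g' h) Y = affine_image g' (affine_image h Y).
  rewrite /affine_image -imset_comp; apply: eq_imset => x /=; ring.
have compK : cancel (comp g) (comp (g.1^-1, - (g.2 / g.1))).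
  by case=> h1 h2; congr (_, _) => /=; field.
have compVK : cancel (comp (g.1^-1, - (g.2 / g.1))) (comp g).
  by case=> h1 h2; congr (_, _) => /=; field.
rewrite -[RHS](card_imset _ (can_inj compK)); apply: eq_card => h.
apply/idP/imsetP => [|[k]]; last first.
  rewrite !inE => /andP[k0 /eqP kX] ->; rewrite compE kX eqxx andbT /=.
  by rewrite mulf_neq0.
rewrite !inE => /andP[h0 /eqP hX]; exists (comp (g.1^-1, - (g.2 / g.1)) h) => //.
rewrite !inE /= mulf_neq0 ?invr_eq0 //= compE hX -compE.
apply/eqP; rewrite -[RHS]imset_id; apply: eq_imset => x /=; by field.
Qed.

(** Sharp 2-transitivity: sending [g] to the preimages of [s] and [t] is a bijection onto the
    ordered pairs of distinct elements of [X]. *)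
Lemma card_affine_image_pair (F : finFieldType) (X : {set F}) (s t : F) : s != t ->
  #|[set g in affine_group F | [set s; t] \subset affine_image g X]| = (#|X| * (#|X| - 1))%N.
Proof.
move=> st.
pose f (g : F * F) := ((s - g.2) / g.1, (t - g.2) / g.1).
have st0 : s - t != 0 by rewrite subr_eq0.
transitivity #|[set xy in setX X X | xy.1 != xy.2]|.
  rewrite -[LHS](card_in_imset (f := f)) => [|[a b] [c d]]; last first.
    rewrite !inE /f /= => /andP[a0 _] /andP[c0 _] [e1 e2].
    have e3 : (s - t) / a = (s - t) / c.
      have -> : (s - t) / a = (s - b) / a - (t - b) / a by field.
      by rewrite e1 e2; field.
    have ac : a = c by apply: invr_inj; apply: (mulfI st0).
    congr (_, _) => //; move: e1; rewrite ac => /(mulIf _) e1.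
    by apply/oppr_inj/(addrI s)/e1; rewrite invr_eq0.
  apply: eq_card => -[x y]; rewrite !inE /=; apply/imsetP/andP => [[[a b]]|[/andP[xX yX] xy]].
    rewrite !inE /= => /andP[a0]; rewrite subUset !sub1set !mem_affine_image // => /andP[sX tX].
    move=> [-> ->]; rewrite sX tX; split=> //.
    apply: contra st => /eqP h; have {}h : s - b = t - b.
      by apply: (mulIf (_ : a^-1 != 0)) => //; rewrite invr_eq0.
    by apply/eqP/(addIr (- b)).
  have xy0 : x - y != 0 by rewrite subr_eq0.
  (* The slope of the affine map taking [x] to [s] and [y] to [t]. *)
  have a0 : (s - t) / (x - y) != 0 by rewrite mulf_neq0 ?invr_eq0.
  have fE : f ((s - t) / (x - y), s - (s - t) / (x - y) * x) = (x, y).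
    by congr (_, _) => /=; field; rewrite ?xy0 ?st0.
  exists ((s - t) / (x - y), s - (s - t) / (x - y) * x) => //.
  rewrite !inE a0 subUset !sub1set !mem_affine_image //.
  by move: fE => [-> ->]; rewrite xX.
have := cardsID [set xy : F * F | xy.1 == xy.2] (setX X X).
rewrite cardsX (_ : setX X X :&: _ = [set (x, x) | x in X]); last first.
  apply/setP => -[x y]; rewrite !inE /=; apply/andP/imsetP.
    by case=> /andP[xX _] /eqP <-; exists x.
  by case=> z zX [-> ->]; rewrite zX eqxx.
rewrite card_imset => [|x y [] //]; rewrite mulnBr muln1 => <-; rewrite addKn.
by apply: eq_card => xy; rewrite !inE andbC.
Qed.

(** Group the maps whose image of [X] contains the given pair by that image: each block arises from
    as many maps as the stabiliser has elements. The stabiliser contains the identity, so the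
    division undoes the multiplication. *)
Lemma affine_design (F : finFieldType) (X : {set F}) :
  is_design 2 #|F| #|X| ((#|X| * (#|X| - 1)) %/ #|affine_stabilizer X|)
    [set: F] (GA1_blocks X).
Proof.
rewrite GA1_blocksE; split=> [|Y /imsetP[g]|S _ /eqP/cards2P[s [t [st ->]]]].
- by rewrite cardsT.
- rewrite inE => g0 ->; split; first exact: subsetT.
  by rewrite card_imset // => x y /addIr/(mulfI g0).
rewrite -(card_affine_image_pair X st) -[X in (X %/ _)%N]sum1_card.
rewrite (partition_big (fun g => affine_image g X)
  (fun Y => Y \in [set Y in [set affine_image g X | g in affine_group F] |
     [set s; t] \subset Y])) /=; last first.
  by move=> g; rewrite !inE => /andP[g0 ->]; rewrite andbT;
    apply: (imset_f (fun g => affine_image g X)); rewrite inE.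
rewrite (eq_bigr (fun=> #|affine_stabilizer X|)) => [|Y].
  rewrite sum_nat_const mulnK //; apply/card_gt0P; exists (1, 0).
  rewrite !inE oner_neq0 /=; apply/eqP; rewrite -[RHS]imset_id; apply: eq_imset => x /=.
  by rewrite mul1r addr0.
rewrite inE => /andP[/imsetP[g gG ->] sub].
rewrite sum1_card -(card_affine_image_fiber X gG); apply: eq_card => h.
by rewrite unfold_in !inE; case: (affine_image h X =P affine_image g X) => [->|_];
  rewrite ?sub ?andbT ?andbF.
Qed.

(** For even [e], -1 is a square, and the reflection exchanges [x] and [x - tau] up to sign. *)
Lemma base_block_reflect (F : finFieldType) (e : nat) (tau x : F) :
  #|F| = e.*2.+1 -> ~~ odd e -> (tau - x \in base_block tau) = (x \in base_block tau).
Proof.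
move=> cardF evene.
have QN y : (- y \in nonzero_squares F) = (y \in nonzero_squares F).
  by rewrite !(euler_criterion cardF) exprNn -signr_odd (negPf evene) mul1r.
by rewrite !in_base_block -(QN (tau - x)) opprB addrAC subrr sub0r QN addbC.
Qed.

Lemma card_affine_stabilizer_odd (F : finFieldType) (e : nat) (tau : F) :
  #|F| = e.*2.+1 -> odd e -> (4 < e)%N -> tau != 0 ->
  #|affine_stabilizer (base_block tau)| = 1%N.
Proof.
move=> cardF odde lt4e tau0; apply/eqP/cards1P; exists (1, 0); apply/setP => -[a b].
rewrite in_set1 inE [_ \in affine_group F]inE /affine_image /=.
apply/andP/eqP => [[a0 /eqP fixB]|[-> ->]].
  by have [a1 b0] := base_block_stabilizer_odd cardF odde lt4e tau0 a0 fixB; congr (_, _).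
rewrite oner_neq0; split=> //; apply/eqP; rewrite -[RHS]imset_id.
by apply: eq_imset => x /=; rewrite mul1r addr0.
Qed.

Lemma card_affine_stabilizer_even (F : finFieldType) (e : nat) (tau : F) :
  #|F| = e.*2.+1 -> ~~ odd e -> (5 < e)%N -> tau != 0 ->
  #|affine_stabilizer (base_block tau)| = 2.
Proof.
move=> cardF evene lt5e tau0.
have -> : affine_stabilizer (base_block tau) = [set (1, 0); (-1, tau)].
  apply/setP => -[a b]; rewrite in_set2 inE [_ \in affine_group F]inE /affine_image /=.
  apply/andP/orP => [[a0 /eqP fixB]|[] /eqP[-> ->]].
  - by case: (base_block_stabilizer_even cardF evene lt5e tau0 a0 fixB) => -[-> ->];
      rewrite eqxx; [left | right].
  - rewrite oner_neq0; split=> //; apply/eqP; rewrite -[RHS]imset_id.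
    by apply: eq_imset => x /=; rewrite mul1r addr0.
  rewrite oppr_eq0 oner_neq0; split=> //; apply/eqP/setP => y.
  rewrite -/(affine_image (-1, tau) _) mem_affine_image /= ?oppr_eq0 ?oner_neq0 //.
  by rewrite invrN1 mulrN1 opprB (base_block_reflect _ _ cardF).
by rewrite cards2 xpair_eqE eq_sym (negPf (opp1_neq1 cardF)).
Qed.

Local Close Scope ring_scope.

Theorem theorem12 (p n q : nat) (F : finFieldType) (tau : F)
    (p_prime : prime p) (p_odd : odd p) (n_gt0 : 0 < n) (q_def : q = p ^ n)
    (q_gt9 : 9 < q) (F_card : #|F| = q) (tau_neq0 : tau != 0%R) :
  [/\ q %% 4 = 3 ->
        let k := (q + 1) %/ 2 in
        is_design 2 q k (k * (k - 1)) [set: F] (GA1_blocks (base_block tau)),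
      q %% 4 = 1 -> tau \in nonzero_squares F ->
        let k := (q + 3) %/ 2 in
        is_design 2 q k ((k * (k - 1)) %/ 2) [set: F]
          (GA1_blocks (base_block tau)) &
      q %% 4 = 1 -> tau \in nonsquares F ->
        let k := (q - 1) %/ 2 in
        is_design 2 q k ((k * (k - 1)) %/ 2) [set: F]
          (GA1_blocks (base_block tau))].
Proof.
pose e := q./2.
have main : q %% 4 = 1 \/ q %% 4 = 3 -> #|F| = e.*2.+1.
  by rewrite F_card /e => -[]; lia.
have des := affine_design (base_block tau).
split=> [q3|q1 tauQ|q1 tauN] k.
- have cardF := main (or_intror q3).
  have odde : odd e by rewrite /e; lia.
  rewrite (card_affine_stabilizer_odd cardF odde _ tau_neq0) ?divn1 in des; last by lia.
  (* Here -1 is a nonsquare, so exactly one of 0 and [tau] lies in the block and [k = e + 1]. *)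
  have kE : #|base_block tau| = k.
    rewrite (card_base_block cardF tau_neq0) (zero_in_base_block cardF).
    rewrite (tau_in_base_block cardF) -signr_odd odde.
    have neg1 := negPf (opp1_neq1 cardF).
    case/orP: (expf_half_sqr1 cardF tau_neq0) => /eqP ->;
      by rewrite ?mulr1 ?mulN1r ?opprK ?eqxx ?neg1 /k; lia.
  by rewrite -F_card -kE.
- have cardF := main (or_introl q1).
  have evene : ~~ odd e by rewrite /e; lia.
  rewrite (card_affine_stabilizer_even cardF evene _ tau_neq0) in des; last by lia.
  (* Both 0 and [tau] lie in the block, so [k = e + 2]. *)
  have kE : #|base_block tau| = k.
    rewrite (card_base_block cardF tau_neq0) (zero_in_base_block cardF).
    rewrite (tau_in_base_block cardF) -signr_odd (negPf evene) expr0 mul1r.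
    by move: tauQ; rewrite (euler_criterion cardF) => ->; rewrite /k; lia.
  by rewrite -F_card -kE.
have cardF := main (or_introl q1).
have evene : ~~ odd e by rewrite /e; lia.
rewrite (card_affine_stabilizer_even cardF evene _ tau_neq0) in des; last by lia.
(* Neither 0 nor [tau] lies in the block, so [k = e]. *)
have kE : #|base_block tau| = k.
  rewrite (card_base_block cardF tau_neq0) (zero_in_base_block cardF).
  rewrite (tau_in_base_block cardF) -signr_odd (negPf evene) expr0 mul1r.
  have : tau \notin nonzero_squares F.
    by move: tauN; rewrite !inE => /negPf ->; rewrite andbF.
  by rewrite (euler_criterion cardF) => /negPf ->; rewrite /k; lia.
by rewrite -F_card -kE.
Qed.
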